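(* Let $(X,d)$ be a compact metric space and let $f\colon X\to X$ be a homeomorphism. Suppose that there is a closed subset $C$ of $X$ with $f(C)=C$ such that (i) $C$ is an infinite set, (ii) $f|_C\colon C\to C$ is chain transitive, (iii) $f$ is expansive on $B_b(C)$ and has shadowing on $B_b(C)$ for some $b>0$. Then $f$ is Bohr chaotic.
   Context: For a closed subset $S$ of a compact metric space $(X,d)$ and $r>0$, $B_r(S)=\{x\in X\colon d(x,S)\le r\}$, where $d(x,S)=\inf_{s\in S}d(x,s)$. For a homeomorphism $f\colon X\to X$ and $x\in X$, $\mathcal{O}_f(x)=\{f^i(x)\colon i\in\mathbb{Z}\}$. Expansiveness on a subset: for $S\subset X$, $f$ is expansive on $S$ if there is $e>0$ such that, for all $x,y\in S$ with $\mathcal{O}_f(x)\cup\mathcal{O}_f(y)\subset S$, $\sup_{i\in\mathbb{Z}}d(f^i(x),f^i(y))\le e$ implies $x=y$. Shadowing on a subset: for $\delta>0$, a sequence $(x_i)_{i\in\mathbb{Z}}$ in $X$ is a $\delta$-pseudo orbit of $f$ if $\sup_{i\in\mathbb{Z}}d(f(x_i),x_{i+1})\le\delta$; it is $\epsilon$-shadowed by $x\in X$ if $\sup_{i\in\mathbb{Z}}d(x_i,f^i(x))\le\epsilon$. For a subset $S\subset X$, $f$ has shadowing on $S$ if for any $\epsilon>0$ there is $\delta>0$ such that every $\delta$-pseudo orbit $(x_i)_{i\in\mathbb{Z}}$ of $f$ with $x_i\in S$ for all $i\in\mathbb{Z}$ is $\epsilon$-shadowed by some $x\in X$ (the shadowing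 point need not lie in $S$). Chain transitivity: a finite sequence $(x_i)_{i=0}^k$, $k\ge1$, is a $\delta$-chain of a homeomorphism $g\colon Z\to Z$ of a compact metric space if $d(g(x_i),x_{i+1})\le\delta$ for all $0\le i\le k-1$. $g$ is chain transitive if for any $x,y\in Z$ and $\delta>0$ there is a $\delta$-chain $(x_i)_{i=0}^k$ of $g$ with $x_0=x$ and $x_k=y$. Bohr chaos: let $C(X)$ be the set of continuous real-valued functions on $X$. A continuous map $f\colon X\to X$ is Bohr chaotic if for every bounded sequence $(a_i)_{i\ge0}$ of real numbers with $\limsup_{n\to\infty}\frac1n\sum_{i=0}^{n-1}|a_i|>0$ there are $x\in X$ and $\phi\in C(X)$ with $\limsup_{n\to\infty}\frac1n\left|\sum_{i=0}^{n-1}a_i\phi(f^i(x))\right|>0$. *)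

(* Defs.v *)
From HB Require Import structures.
From mathcomp Require Import all_boot all_order all_algebra.
From mathcomp Require Import all_classical all_reals all_analysis.

Set Implicit Arguments.
Unset Strict Implicit.
Unset Printing Implicit Defensive.

Import Order.TTheory GRing.Theory Num.Theory.
Import numFieldNormedType.Exports.

Local Open Scope classical_set_scope.
Local Open Scope ring_scope.

(* The inverse is part of the data only to make the iterates f^i, i : int,
   definable; it is determined by the underlying function. *)
Record homeo (T : topologicalType) := Homeo {
  homeo_fun :> T -> T;
  homeo_inv : T -> T;
  homeo_funK : cancel homeo_fun homeo_inv;
  homeo_invK : cancel homeo_inv homeo_fun;
  homeo_fun_continuous : continuous homeo_fun;
  homeo_inv_continuous : continuous homeo_inv
}.

(* Negz n is the integer - (n.+1). *)
Definition ziter (T : topologicalType) (f : homeo T) (i : int) : T -> T :=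
  match i with
  | Posz n => iter n f
  | Negz n => iter n.+1 (homeo_inv f)
  end.

Definition orbitz (T : topologicalType) (f : homeo T) (x : T) : set T :=
  [set ziter f i x | i in [set: int]].

Section metric_notions.
Context {R : realType} {X : metricType R}.

(* Extended-real valued, so that the distance to the empty set is +oo. *)
Definition dist_set (x : X) (S : set X) : \bar R :=
  ereal_inf [set (mdist x s)%:E | s in S].

Definition nbhd_set (r : R) (S : set X) : set X :=
  [set x | (dist_set x S <= r%:E)%E].

Definition sup_dist (u v : int -> X) : \bar R :=
  ereal_sup [set (mdist (u i) (v i))%:E | i in [set: int]].

Definition expansive_on (f : homeo X) (S : set X) : Prop :=
  exists2 e : R, 0 < e &
    forall x y : X, S x -> S y -> orbitz f x `|` orbitz f y `<=` S ->
      (sup_dist (ziter f ^~ x) (ziter f ^~ y) <= e%:E)%E -> x = y.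

Definition pseudo_orbit (f : X -> X) (delta : R) (x : int -> X) : Prop :=
  (sup_dist (fun i => f (x i)) (fun i => x (i + 1)%R) <= delta%:E)%E.

Definition shadowed (f : homeo X) (eps : R) (xs : int -> X) (x : X) : Prop :=
  (sup_dist xs (ziter f ^~ x) <= eps%:E)%E.

Definition shadowing_on (f : homeo X) (S : set X) : Prop :=
  forall eps : R, 0 < eps -> exists2 delta : R, 0 < delta &
    forall xs : int -> X, pseudo_orbit f delta xs -> (forall i, S (xs i)) ->
      exists x : X, shadowed f eps xs x.

(* The chain is x 0, ..., x k; the values of x beyond k are irrelevant. *)
Definition chain (g : X -> X) (delta : R) (k : nat) (x : nat -> X) : Prop :=
  (1 <= k)%N /\ forall i, (i < k)%N -> mdist (g (x i)) (x i.+1) <= delta.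

(* Chain transitivity of the restriction g|_C : C -> C, for C with g(C) = C:
   end points and intermediate points all range over C. *)
Definition chain_transitive_on (g : X -> X) (C : set X) : Prop :=
  forall x y : X, C x -> C y -> forall delta : R, 0 < delta ->
    exists (k : nat) (z : nat -> X),
      [/\ chain g delta k z, forall i, (i <= k)%N -> C (z i),
          z 0%N = x & z k = y].

(* At n = 0 both averages are 0, which does not affect the limits superior. *)
Definition bohr_chaotic (f : X -> X) : Prop :=
  forall a : nat -> R, bounded_fun a ->
    (0 < limn_esup (fun n => (n%:R^-1 * \sum_(0 <= i < n) `|a i|)%R%:E))%E ->
    exists (x : X) (phi : X -> R), continuous phi /\
      (0 < limn_esup (fun n =>
         (n%:R^-1 * `| \sum_(0 <= i < n) a i * phi (iter i f x) |)%R%:E))%E.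

End metric_notions.

(* Main.v *)
(* Shadowing and expansiveness near the infinite chain transitive set C produce
   a periodic point p and a point x off its orbit whose orbit is asymptotic, in
   both time directions and with the same phase, to that of p. As x is isolated
   from the rest of its orbit and from the orbit of p, and as both orbits can be
   cut into blocks of a common length m that concatenate freely into
   pseudo-orbits, for every set W of times in one residue class mod m some true
   orbit comes near x exactly at the times of W. Given (a_i), take for W the
   times in a suitable class mod m at which a_i has a suitable sign, and for the
   test function a bump at x: no cancellation occurs. *)
Require Import Defs.
From HB Require Import structures.
From mathcomp Require Import all_boot all_order all_algebra.
From mathcomp Require Import all_classical all_reals all_analysis.
From mathcomp Require Import zify lra.

Set Implicit Arguments.
Unset Strict Implicit.
Unset Printing Implicit Defensive.

Import Order.TTheory GRing.Theory Num.Theory.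
Import numFieldNormedType.Exports.

Local Open Scope classical_set_scope.
Local Open Scope ring_scope.

(** * Residues of consecutive integers and minima of finite families *)

Lemma modzS (i m : int) : 0 < m ->
  ((i + 1) %% m)%Z = (i %% m)%Z + 1 \/
  (i %% m)%Z + 1 = m /\ ((i + 1) %% m)%Z = 0.
Proof.
move=> m0; have := ltz_pmod i m0; have := @modz_ge0 i m ltac:(lia).
have -> : ((i + 1) %% m)%Z = ((i %% m)%Z + 1) %% m :> int by rewrite modzDml.
set r := (i %% m)%Z => r0 rm.
have [rm1|rm1] := eqVneq (r + 1) m; first by right; rewrite rm1 modzz.
by left; rewrite modz_small //; lia.
Qed.

Lemma positive_lower_bound (R : realType) (n : nat) (g : nat -> R) :
  (forall i, (i < n)%N -> 0 < g i) ->
  exists2 k : R, 0 < k & forall i, (i < n)%N -> k <= g i.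
Proof.
elim: n => [|n IHn] g0; first by exists 1.
have [k k0 kg] := IHn (fun i lin => g0 i (ltnW lin)).
exists (Num.min k (g n)); first by rewrite lt_min k0 g0.
move=> i; rewrite ltnS leq_eqVlt => /predU1P[->|/kg kgi].
  by rewrite ge_min lexx orbT.
by rewrite ge_min kgi.
Qed.

(** * Iterates indexed by the integers *)

Section Iterates.
Context {T : topologicalType} (f : homeo T).

Lemma ziterS (i : int) x : ziter f (i + 1) x = f (ziter f i x).
Proof.
case: i => [n|[|n]]; first by have -> : n%:Z + 1 = n.+1 by lia.
  by rewrite /= homeo_invK.
have -> : Negz n.+1 + 1 = Negz n by lia.
by rewrite /= homeo_invK.
Qed.

Lemma ziterP (i : int) x : ziter f (i - 1) x = homeo_inv f (ziter f i x).
Proof. by rewrite -[in RHS](subrK 1 i) ziterS homeo_funK. Qed.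

Lemma ziterD (i j : int) x : ziter f (i + j) x = ziter f i (ziter f j x).
Proof.
elim: i => [|n IHn|n IHn]; first by rewrite add0r.
  have -> : n.+1%:Z + j = n%:Z + j + 1 by lia.
  have -> : n.+1%:Z = n%:Z + 1 by lia.
  by rewrite !ziterS IHn.
have -> : - n.+1%:Z + j = - n%:Z + j - 1 by lia.
have -> : - n.+1%:Z = - n%:Z - 1 by lia.
by rewrite !ziterP IHn.
Qed.

Lemma ziter_fixed_mul (i k : int) x :
  ziter f i x = x -> ziter f (k * i) x = x.
Proof.
move=> fix_x; elim: k => [|n IHn|n IHn]; first by rewrite mul0r.
  have -> : n.+1%:Z * i = n%:Z * i + i by lia.
  by rewrite ziterD fix_x.
have -> : - n.+1%:Z * i = - i + - n%:Z * i by lia.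
by rewrite ziterD IHn -[in LHS]fix_x -ziterD addNr.
Qed.

Lemma ziter_mod (l i : int) x :
  ziter f l x = x -> ziter f i x = ziter f (i %% l)%Z x.
Proof.
by move=> fix_x; rewrite [in LHS](divz_eq i l) addrC ziterD ziter_fixed_mul.
Qed.

Lemma ziter_continuous (i : int) : continuous (ziter f i).
Proof.
have iterc (g : T -> T) n : continuous g -> continuous (iter n g).
  move=> gc; elim: n => [|n IHn] x /=; first exact: cvg_id.
  by apply: (@continuous_comp _ _ _ (iter n g) g); [exact: IHn|exact: gc].
case: i => n; apply: iterc => x; first exact: homeo_fun_continuous.
exact: homeo_inv_continuous.
Qed.

End Iterates.

(** * The suprema and infima of the definitions as pointwise bounds *)

Section Metric.
Context {R : realType} {X : metricType R}.
Implicit Types (f : homeo X) (x y : X) (C S : set X).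

Lemma sup_distP (u v : int -> X) (r : R) :
  (sup_dist u v <= r%:E)%E <-> forall i, mdist (u i) (v i) <= r.
Proof.
split=> [/ereal_supP uv i|uv].
  by rewrite -lee_fin; apply: uv; exists i.
by apply/ereal_supP => _ [i _ <-]; rewrite lee_fin.
Qed.

Lemma nbhd_setI C c x (r : R) : C c -> mdist x c <= r -> nbhd_set r C x.
Proof.
by move=> Cc xc; apply: ge_ereal_inf; exists (mdist x c)%:E => //; exists c.
Qed.

Lemma expansive_onE f S : expansive_on f S -> exists2 e : R, 0 < e &
  forall x y, (forall i, S (ziter f i x)) -> (forall i, S (ziter f i y)) ->
    (forall i, mdist (ziter f i x) (ziter f i y) <= e) -> x = y.
Proof.
move=> [e e0 exp]; exists e => // x y Sx Sy xy; apply: exp.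
- exact: (Sx 0).
- exact: (Sy 0).
- by move=> z [|] [i _ <-].
- exact/sup_distP.
Qed.

Lemma shadowing_onE f S : shadowing_on f S -> forall eps : R, 0 < eps ->
  exists2 delta : R, 0 < delta & forall xs : int -> X,
    (forall i, mdist (f (xs i)) (xs (i + 1)) <= delta) ->
    (forall i, S (xs i)) ->
    exists x, forall i, mdist (xs i) (ziter f i x) <= eps.
Proof.
move=> sh eps /sh[delta d0 {}sh]; exists delta => // xs xsd xsS.
have /sup_distP xsP := xsd.
by have [x /sup_distP xP] := sh xs xsP xsS; exists x.
Qed.

End Metric.

(** * Upper means and the reduction of Bohr chaos to interpolation *)

Section Averages.
Context {R : realType}.

Lemma limn_esup_gt0P (u : nat -> R) : (0 < limn_esup (fun n => (u n)%:E))%E <->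
  exists2 k : R, 0 < k & forall N, exists2 n, (N <= n)%N & k <= u n.
Proof.
split=> [u0|[k k0 ku]]; last first.
  apply: (@lt_le_trans _ _ k%:E); first by rewrite lte_fin.
  apply: le_ereal_inf_tmp => _ [V [N _ NV] <-].
  have [n Nn kn] := ku N.
  apply: (@le_trans _ _ (u n)%:E); first by rewrite lee_fin.
  by apply: ereal_sup_ubound; exists n => //; exact: NV.
have [k k0 ku] : exists2 k : R, 0 < k &
    (k%:E < limn_esup (fun n => (u n)%:E))%E.
  case: (limn_esup _) u0 => [r|_|//].
    rewrite lte_fin => r0; exists (r / 2); first by lra.
    by rewrite lte_fin; lra.
  by exists 1 => //; exact: ltry.
exists k => // N.
have : (k%:E < ereal_sup [set (u n)%:E | n in [set n | (N <= n)%N]])%E.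
  apply: (lt_le_trans ku); apply: ereal_inf_lbound.
  by exists [set n | (N <= n)%N] => //; exists N.
by move=> /ereal_sup_gt[_ [n Nn <-]]; rewrite lte_fin => /ltW kn; exists n.
Qed.

(** Pigeonhole: otherwise each summand is eventually below [k / #|I|.+1], and the sum below [k]. The
    successor keeps the bound strict and covers an empty [I]. *)
Lemma limn_esup_sum_gt0 (I : finType) (u : I -> nat -> R) :
  (0 < limn_esup (fun n => (\sum_i u i n)%:E))%E ->
  exists i, (0 < limn_esup (fun n => (u i n)%:E))%E.
Proof.
move=> /limn_esup_gt0P[k k0 ku]; apply: contrapT => /forallNP u_le0.
pose k' := k / #|I|.+1%:R.
have k'0 : 0 < k' by rewrite divr_gt0.
have /choice[N uN] i : exists N, forall n, (N <= n)%N -> u i n < k'.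
  apply: contrapT => /forallNP uk; apply: (u_le0 i).
  apply/limn_esup_gt0P; exists k' => // N; have /existsNP[n] := uk N.
  by move=> /not_implyP[Nn /negP]; rewrite -leNgt => kn; exists n.
have [n Nn] := ku (\max_i N i).
suff : \sum_i u i n < k by move=> ? ?; lra.
apply: (@le_lt_trans _ _ (\sum_(i : I) k')).
  apply: ler_sum => i _; apply/ltW/uN; apply: leq_trans Nn.
  exact: leq_bigmax.
rewrite sumr_const -[X in _ < X](divfK (_ : #|I|.+1%:R != 0)) //.
by rewrite -[ltLHS]mulr_natr ltr_pM2l // ltr_nat.
Qed.

(** Splitting the indices by residue mod [m] and sign of [a], some class carries a positive upper
    mean of [|a i|]. With [w] this class, all nonzero terms of the tested sum have the same sign, so
    its absolute value is at least [k] times the part of the class. *)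
Lemma bohr_chaotic_interpolation (X : metricType R) (g : X -> X)
    (phi : X -> R) (k : R) (m : nat) :
  continuous phi -> 0 < k -> (0 < m)%N ->
  (forall (r : nat) (w : pred nat), (forall n, w n -> n %% m = r)%N ->
    exists x, forall n, if w n then k <= phi (iter n g x) : Prop
                        else phi (iter n g x) = 0) ->
  bohr_chaotic g.
Proof.
move=> phic k0 m0 interp a _ a_gt0.
pose cls i : 'I_m * bool := (Ordinal (ltn_pmod i m0), 0 <= a i).
pose u s n := n%:R^-1 * \sum_(0 <= i < n) (if s == cls i then `|a i| else 0).
have [[r s] /limn_esup_gt0P[c c0 cu]] :
    exists s, (0 < limn_esup (fun n => (u s n)%:E))%E.
  apply: limn_esup_sum_gt0; move: a_gt0; congr (0 < limn_esup _)%E.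
  apply/funext => n; congr (_%:E); rewrite /u -big_distrr /=.
  rewrite exchange_big /=; congr (_ * _); apply: eq_bigr => i _.
  by rewrite -big_mkcond big_pred1_eq.
have [|x xP] := interp r (fun n => (r, s) == cls n).
  by move=> n /eqP[-> _].
exists x, phi; split=> //; apply/limn_esup_gt0P.
exists (k * c); first exact: mulr_gt0.
move=> N; have [n Nn cn] := cu N; exists n => //.
apply: (@le_trans _ _ (k * u (r, s) n)); first by rewrite ler_pM2l.
rewrite /u mulrCA ler_wpM2l ?invr_ge0 //.
pose sg : R := if s then 1 else -1.
apply: (@le_trans _ _ (sg * \sum_(0 <= i < n) a i * phi (iter i g x))); last first.
  by rewrite /sg; case: (s); rewrite ?mul1r ?mulN1r ?ler_norm // -normrN ler_norm.
rewrite !big_distrr /=; apply: ler_sum => i _.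
have := xP i; case: eqP => [[_ sE]|_ ->]; last by rewrite !mulr0.
move=> kphi; rewrite mulrA mulrC.
suff -> : sg * a i = `|a i| by rewrite ler_wpM2l.
rewrite /sg sE; case: lerP => ai.
  by rewrite mul1r ?ger0_norm.
by rewrite mulN1r ltr0_norm.
Qed.

End Averages.

(** * Homoclinic points and the orbits they encode *)

Section Homoclinic.
Context {R : realType} {X : metricType R} (f : homeo X).

Definition homoclinic (l : nat) (p x : X) : Prop :=
  [/\ (0 < l)%N, ziter f l p = p, forall i, ziter f i p <> x &
      forall eta : R, 0 < eta -> exists K : nat, forall i : int,
        (K <= absz i)%N -> mdist (ziter f i x) (ziter f i p) <= eta].

(** The orbit of [p] is finite and misses [x], hence stays [k1] away. At late times the orbit of [x]
    is close to that of [p], so far from [x]; thus [x] is not periodic, since multiples of a period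
    are late times. Finitely many times remain. *)
Lemma homoclinic_isolated l p x : homoclinic l p x -> exists2 k : R, 0 < k &
  (forall i, k <= mdist x (ziter f i p)) /\
  (forall i, i != 0 -> k <= mdist x (ziter f i x)).
Proof.
move=> [l0 fp px asym].
have [|k1 k10 k1P] := @positive_lower_bound _ l
    (fun i => mdist x (ziter f i p)).
  by move=> i _; rewrite mdist_gt0; apply/eqP => /esym; exact: px.
have kp i : k1 <= mdist x (ziter f i p).
  rewrite (ziter_mod i fp); have := @modz_ge0 i l ltac:(lia).
  have := @ltz_pmod i l ltac:(lia).
  by case: (_ %% _)%Z => // n ? _; apply: k1P; lia.
have [K KP] := asym (k1 / 2) ltac:(lra).
have far i : (K <= absz i)%N -> k1 / 2 <= mdist x (ziter f i x).
  move=> /KP; have := kp i.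
  have := metric_triangle x (ziter f i x) (ziter f i p); lra.
have aperiodic i : i != 0 -> ziter f i x <> x.
  move=> i0 fix_x; have /far : (K <= absz (K.+1%:Z * i)%R)%N.
    by rewrite abszM (leq_trans (leqnSn K)) // leq_pmulr // absz_gt0.
  by rewrite ziter_fixed_mul // mdistxx; lra.
have [|k2 k20 k2P] := @positive_lower_bound _ K.+1
    (fun i => Num.min (mdist x (ziter f i.+1 x)) (mdist x (ziter f (- i.+1%:Z) x))).
  move=> i _; rewrite lt_min !mdist_gt0.
  by apply/andP; split; apply/eqP => /esym; apply: aperiodic; lia.
exists (Num.min (k1 / 2) k2); first by rewrite lt_min k20; lra.
split=> i; first by rewrite ge_min; apply/orP; left; have := kp i; lra.
move=> i0; rewrite ge_min; apply/orP.
have [/far|iK] := leqP K (absz i); [by left|right].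
have := k2P (absz i).-1 ltac:(lia); rewrite le_min => /andP[].
by case: i i0 {iK} => [[|n]|n].
Qed.

(* Pseudo-orbit made of blocks of length 2L centred at the times congruent to r
   mod 2L: a block follows the orbit of x if w selects its centre, and the
   orbit of p otherwise. The point phi tests is only met at selected centres. *)
Lemma homoclinic_bohr S l p x : homoclinic l p x -> shadowing_on f S ->
  (forall i, S (ziter f i p)) -> (forall i, S (ziter f i x)) ->
  bohr_chaotic f.
Proof.
move=> hom /shadowing_onE shad Sp Sx.
have [k k0 [kp kx]] := homoclinic_isolated hom.
have [l0 fp _ asym] := hom.
have [|delta delta0 shadP] := shad (k / 3); first by lra.
have [K KP] := asym (delta / 2) ltac:(lra).
(* A multiple of [l], so that [p] is back at itself at both block ends; at least [K], so that [x] is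
   then within [delta / 2] of [p]. *)
pose L : nat := (K.+1 * l)%N; have L0 : (0 < L)%N by rewrite muln_gt0.
have KL : (K <= L)%N by rewrite /L; nia.
(* At least [k / 3] within [k / 3] of [x], and zero from distance [2 * (k / 3)] on: a shadowing
   error of [k / 3] is harmless in both cases. *)
pose phi u := Num.max 0 (2 * (k / 3) - mdist x u).
have phic : continuous phi.
  move=> u; apply/cvgrPdist_le => eps e0.
  apply/metricType_numDomainType.nbhs_mdistP; exists eps => // v /= uv.
  have := metric_triangle x u v; have := metric_triangle x v u.
  rewrite (metric_sym v u) /phi => ? ?.
  by rewrite ler_norml !maxEle; case: ifP => ?; case: ifP => ?; lra.
apply: (@bohr_chaotic_interpolation _ _ _ phi (k / 3) (2 * L)) => //.
- by lra.
- by rewrite muln_gt0.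
move=> r w wr.
pose sel (z : int) := if z is Posz n then w n else false.
pose m : int := (2 * L)%N; have m0 : 0 < m by rewrite /m; lia.
(* Position of [i] in its block, between [- L] and [L - 1]; the centre of the block is [i - j i]. *)
pose j (i : int) : int := ((i - r%:Z + L%:Z) %% m)%Z - L%:Z.
pose xi (i : int) := ziter f (j i) (if sel (i - j i) then x else p).
have fLp (z : int) : z = L \/ z = - L%:Z -> ziter f z p = p.
  by case=> ->; [|rewrite -mulN1r]; rewrite /L PoszM ?mulrA ziter_fixed_mul.
have xi_end (z : int) (b : bool) : z = L \/ z = - L%:Z ->
    mdist (ziter f z (if b then x else p)) p <= delta / 2.
  move=> zL; rewrite -{2}(fLp z zL); case: b; last by rewrite mdistxx; lra.
  by apply: KP; case: zL => ->; rewrite ?abszN.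
have [i||y yP] := shadP xi.
- have ji1 : i + 1 - r%:Z + L%:Z = (i - r%:Z + L%:Z) + 1 by lia.
  rewrite /xi -ziterS; have [ji|[ji ji0]] := modzS (i - r%:Z + L%:Z) m0.
    have -> : j (i + 1) = j i + 1 by rewrite /j ji1 ji; lia.
    have -> : i + 1 - (j i + 1) = i - j i by lia.
    by rewrite mdistxx ltW.
  (* Junction of two blocks: the end of one and the start of the next are both within [delta / 2] of
     [p]. *)
  have -> : j (i + 1) = - L%:Z by rewrite /j ji1 ji0 sub0r.
  have -> : j i + 1 = L by rewrite /j; move: ji; rewrite /m; lia.
  set b := sel _; set c := sel _.
  have := xi_end L b (or_introl erefl).
  have := xi_end (- L%:Z) c (or_intror erefl).
  have := metric_triangle (ziter f L (if b then x else p)) p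
     (ziter f (- L%:Z) (if c then x else p)).
  by rewrite (metric_sym p); lra.
- by move=> i; rewrite /xi; case: (sel _).
exists y => n; have := yP n; rewrite -[iter n f y]/(ziter f n y) => ny.
case: ifP => wn.
  have jn : j n = 0.
    rewrite /j; suff -> : ((n%:Z - r%:Z + L%:Z) %% m)%Z = L by lia.
    have -> : n%:Z - r%:Z = (n %/ (2 * L))%N%:Z * m.
      by have := divn_eq n (2 * L); rewrite (wr n wn) /m; lia.
    by rewrite modzMDl modz_small // /m; lia.
  move: ny; rewrite /xi jn subr0 /sel wn /= => ny.
  by rewrite /phi le_max; apply/orP; right; lra.
(* Either [xi n] is on the orbit of [p], or it is an iterate of [x] at a nonzero time, as [n] is not
   a selected centre. *)
have far : k <= mdist x (xi n).
  rewrite /xi; case: ifP => // sn; apply: kx; apply/negP => /eqP jn.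
  by move: sn; rewrite jn subr0 /= wn.
rewrite /phi; apply/eqP; rewrite eq_le le_max lexx andbT ge_max lexx /=.
have := metric_triangle x (ziter f n y) (xi n); rewrite (metric_sym (ziter f n y)).
by lra.
Qed.

End Homoclinic.

(** * Concatenation of chains and periodic pseudo-orbits *)

Section Chains.
Context {R : realType} {X : metricType R} (f : homeo X) (C : set X).

Definition chain_in (delta : R) (k : nat) (w : nat -> X) : Prop :=
  chain f delta k w /\ forall i, (i <= k)%N -> C (w i).

Lemma chain_in_cat delta k1 w1 k2 w2 :
  chain_in delta k1 w1 -> chain_in delta k2 w2 -> w1 k1 = w2 0%N ->
  exists w, [/\ chain_in delta (k1 + k2) w,
    forall i, (i <= k1)%N -> w i = w1 i & forall i, w (k1 + i)%N = w2 i].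
Proof.
move=> [[k10 w1d] w1C] [[k20 w2d] w2C] w12.
pose w i := if (i <= k1)%N then w1 i else w2 (i - k1)%N.
have wl i : (i <= k1)%N -> w i = w1 i by rewrite /w => ->.
have wr i : w (k1 + i)%N = w2 i.
  case: i => [|i]; first by rewrite addn0 wl.
  by rewrite /w ifF ?addKn //; lia.
exists w; split=> //; split; [split; first lia|] => i ik.
  have [ik1|k1i] := ltnP i k1; first by rewrite !wl ?w1d // ltnW.
  by rewrite -(subnKC k1i) -addnS !wr w2d //; lia.
have [ik1|/ltnW k1i] := leqP i k1; first by rewrite wl //; apply: w1C.
by rewrite -(subnKC k1i) wr; apply: w2C; lia.
Qed.

(** Where the index wraps around, [w 0] is read as [w k], which makes the step the last link of the
    chain. *)
Lemma cycle_pseudo_orbit delta k w : chain_in delta k w -> w 0%N = w k ->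
  forall i : int,
    mdist (f (w (absz (i %% k)%Z))) (w (absz ((i + 1) %% k)%Z)) <= delta.
Proof.
move=> [[k0 wd] _] w0k i.
have := @modz_ge0 i k ltac:(lia); have := @ltz_pmod i k ltac:(lia).
have [->|[ik ->]] := @modzS i k ltac:(lia); first last.
  move: ik; case: (i %% k)%Z => // n nk _ _.
  rewrite w0k (_ : k = n.+1); last by lia.
  by apply: wd; lia.
case: (i %% k)%Z => // n nk _.
by rewrite (_ : n%:Z + 1 = n.+1) /=; [apply: wd; lia|lia].
Qed.

Lemma cycle_in delta k w : chain_in delta k w ->
  forall i : int, C (w (absz (i %% k)%Z)).
Proof.
move=> [[k0 _] wC] i; apply: wC.
have := @modz_ge0 i k ltac:(lia); have := @ltz_pmod i k ltac:(lia); lia.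
Qed.

Lemma ziter_invariant : f @` C = C ->
  forall i x, C x -> C (ziter f i x).
Proof.
move=> fC i x Cx; elim: i => [//|n Cn|n Cn].
  have -> : n.+1%:Z = n%:Z + 1 by lia.
  by rewrite ziterS -fC; exists (ziter f n x).
have -> : - n.+1%:Z = - n%:Z - 1 by lia.
by move: Cn; rewrite ziterP -{1}fC => -[c Cc <-]; rewrite homeo_funK.
Qed.

End Chains.

(** * Existence of a homoclinic point near [C] *)

Section Existence.
Context {R : realType} {X : metricType R} (f : homeo X) (C : set X).
Context (b e eps : R).
Hypotheses (eps_b : eps < b) (compactX : compact [set: X]).
Hypothesis expansive : forall x y : X,
  (forall i, nbhd_set b C (ziter f i x)) ->
  (forall i, nbhd_set b C (ziter f i y)) ->
  (forall i, mdist (ziter f i x) (ziter f i y) <= e) -> x = y.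

(** The slack between [eps] and [b] keeps the orbits of limits of such points inside the
    [b]-neighbourhood, where expansivity applies. *)
Let near_C (u : X) := forall i, exists2 c, C c & mdist (ziter f i u) c <= eps.

Lemma near_orbit u : near_C u -> forall i, nbhd_set b C (ziter f i u).
Proof.
move=> uC i; have [c Cc uc] := uC i; apply: (nbhd_setI Cc).
exact: le_trans uc (ltW eps_b).
Qed.

(** Compactness: counterexamples for every [K] cluster at a pair [(u, v)] whose orbits are [e]-close
    at all times, so [u = v] by expansivity, although the counterexamples stay more than [eta]
    apart. *)
Lemma uniform_expansivity (eta : R) : 0 < eta -> exists K : nat, forall u v,
  near_C u -> near_C v ->
  (forall i : int, (absz i <= K)%N ->
    mdist (ziter f i u) (ziter f i v) <= e) -> mdist u v <= eta.
Proof.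
move=> eta0; apply: contrapT => /forallNP noK.
have /choice[w wP] K : exists w : X * X, [/\ near_C w.1, near_C w.2,
    forall i : int, (absz i <= K)%N ->
      mdist (ziter f i w.1) (ziter f i w.2) <= e & eta < mdist w.1 w.2].
  apply: contrapT => now; apply: (noK K) => u v uC vC uv.
  by rewrite leNgt; apply/negP => ?; apply: now; exists (u, v).
have [|[u v] [_ uv]] := compact_setX compactX compactX
    (fmap_proper_filter w eventually_filter).
  by exists 0%N.
have approx (i : int) (k : R) (N : nat) : 0 < k -> exists n, [/\ (N <= n)%N,
    mdist (ziter f i u) (ziter f i (w n).1) < k &
    mdist (ziter f i v) (ziter f i (w n).2) < k].
  move=> k0.
  pose B (z : X) := [set z' | mdist (ziter f i z) (ziter f i z') < k].
  have nB z : nbhs z (B z).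
    exact: (metricType_numDomainType.cvgr_dist_lt (@ziter_continuous _ f i z) k0).
  have [||[u' v'] [[n Nn wn] []]] := uv (w @` [set n | (N <= n)%N]) (B u `*` B v).
  - by exists N => // n Nn; exists n.
  - by exists (B u, B v) => //; split; exact: nB.
  by rewrite /B /= => ? ?; exists n; rewrite wn.
have uv_eq : u = v.
  have beps : 0 < b - eps by rewrite subr_gt0.
  apply: expansive => i.
  - have [n [_ un _]] := approx i _ 0%N beps.
    have [/(_ i)[c Cc unc] _ _ _] := wP n; apply: (nbhd_setI Cc).
    have := metric_triangle (ziter f i u) (ziter f i (w n).1) c; lra.
  - have [n [_ _ vn]] := approx i _ 0%N beps.
    have [_ /(_ i)[c Cc vnc] _ _] := wP n; apply: (nbhd_setI Cc).
    have := metric_triangle (ziter f i v) (ziter f i (w n).2) c; lra.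
  apply/ler_addgt0Pr => k k0.
  (* Taking [n] at least [absz i] puts time [i] in the window where the [n]-th pair is [e]-close. *)
  have [n [ni un vn]] := approx i (k / 2) (absz i) ltac:(lra).
  have [_ _ /(_ i ni) uvn _] := wP n.
  have := metric_triangle (ziter f i u) (ziter f i (w n).1) (ziter f i v).
  have := metric_triangle (ziter f i (w n).1) (ziter f i (w n).2) (ziter f i v).
  by rewrite (metric_sym (ziter f i (w n).2) (ziter f i v)); lra.
have [n [_ un vn]] := approx 0 (eta / 2) 0%N ltac:(lra).
have [_ _ _] := wP n.
have := metric_triangle (w n).1 v (w n).2.
by move: un vn; rewrite /= uv_eq (metric_sym v (w n).1); lra.
Qed.

Context (delta : R).
Hypotheses (eps_e : eps + eps <= e) (delta0 : 0 < delta).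
Hypothesis shadowing : forall xs : int -> X,
  (forall i, mdist (f (xs i)) (xs (i + 1)) <= delta) -> (forall i, C (xs i)) ->
  exists x, forall i, mdist (xs i) (ziter f i x) <= eps.

Let shadow_near (xs : int -> X) (x : X) : (forall i, C (xs i)) ->
  (forall i, mdist (xs i) (ziter f i x) <= eps) ->
  forall k, near_C (ziter f k x).
Proof.
move=> xsC xs_x k i; exists (xs (i + k)) => //.
by rewrite -ziterD metric_sym.
Qed.

Let shadow_close (xs ys : int -> X) (x y : X) i :
  (forall i, mdist (xs i) (ziter f i x) <= eps) ->
  (forall i, mdist (ys i) (ziter f i y) <= eps) ->
  xs i = ys i -> mdist (ziter f i x) (ziter f i y) <= e.
Proof.
move=> /(_ i) xs_x /(_ i) ys_y xy; rewrite -xy in ys_y.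
have := metric_triangle (ziter f i x) (xs i) (ziter f i y).
by move: eps_e; rewrite (metric_sym (ziter f i x) (xs i)); lra.
Qed.

(* Take a periodic point p shadowing a cycle of C, and z in C off its orbit.
   Insert into the cycle of p, l times so as not to shift the phase, a cycle
   following the orbit of z for so long that no point of the orbit of p
   shadows it. *)
Lemma homoclinic_exists : f @` C = C -> infinite_set C ->
  chain_transitive_on f C ->
  exists l p x, [/\ homoclinic f l p x, near_C p & near_C x].
Proof.
move=> fC infC chainC.
have zC := ziter_invariant fC.
have chn u v : C u -> C v -> exists k w,
    [/\ chain_in f C delta k w, w 0%N = u & w k = v].
  by move=> Cu Cv; have [k [w [? ? ? ?]]] := chainC u v Cu Cv delta delta0;
    exists k, w.
have [y Cy] := infinite_setN0 infC.
have [l [g [g_chain g0 gl]]] := chn y y Cy Cy.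
have l0 : (0 < l)%N by case: g_chain => -[].
pose gz (i : int) := g (absz (i %% l)%Z).
have gzC : forall i, C (gz i) := cycle_in g_chain.
have gzd := cycle_pseudo_orbit g_chain (etrans g0 (esym gl)).
have [p gp] := shadowing gzd gzC.
have eps0 : 0 <= eps := le_trans (mdist_ge0 _ _) (gp 0).
have pC := shadow_near gzC gp.
(* Both points shadow the same [l]-periodic pseudo-orbit, so expansivity identifies them. *)
have flp : ziter f l p = p.
  apply: expansive => [i|i|i]; [exact: near_orbit|exact: (near_orbit (pC 0))|].
  apply: (shadow_close (xs := fun i => gz (i + l)) _ gp) => [j|].
    by rewrite -ziterD; exact: gp.
  by rewrite /gz modzDr.
have [z [Cz pz]] : exists z, C z /\ forall i, ziter f i p <> z.
  apply: contrapT => noz; apply: infC.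
  apply: (@sub_finite_set _ _ ((fun n : nat => ziter f n p) @` `I_l)); last first.
    exact/finite_image/finite_II.
  move=> z Cz; apply: contrapT => zp; apply: noz; exists z; split=> // i iz.
  apply: zp; move: iz; rewrite (ziter_mod i flp).
  have := @modz_ge0 i l ltac:(lia); have := @ltz_pmod i l ltac:(lia).
  by case: (i %% l)%Z => // n nl _ nz; exists n => //=; lia.
(* Expansivity separates [z] from each point of the orbit of [p]; one period gives finitely many
   separation times, bounded by [N]. *)
have /choice[sep sepP] n : exists i, e < mdist (ziter f i (ziter f n%:Z p)) (ziter f i z).
  apply: contrapT => /forallNP nsep; apply: (pz n); apply: expansive => [i|i|i].
  - exact: (near_orbit (pC n)).
  - by apply: (nbhd_setI (zC i z Cz)); rewrite mdistxx (le_trans eps0) // ltW.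
  - by rewrite leNgt; apply/negP/nsep.
pose N := \max_(n < l) absz (sep n).
have [k1 [w1 [w1_chain w10 w1k]]] := chn y _ Cy (zC (- N.+1%:Z) z Cz).
have [k3 [w3 [w3_chain w30 w3k]]] := chn _ y (zC N.+1 z Cz) Cy.
pose w2 (n : nat) := ziter f (n%:Z - N.+1%:Z) z.
have w2_chain : chain_in f C delta (2 * N.+1) w2.
  split=> [|n _]; last exact: zC.
  split=> // n _; rewrite /w2 -ziterS.
  have -> : n%:Z - N.+1%:Z + 1 = n.+1%:Z - N.+1%:Z by lia.
  by rewrite mdistxx ltW.
have [|w23 [w23_chain w23l w23r]] := chain_in_cat w2_chain w3_chain.
  by rewrite w30 /w2; congr (ziter f _ z); lia.
have [|q [q_chain ql qr]] := chain_in_cat w1_chain w23_chain.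
  by rewrite w1k w23l // /w2 sub0r.
set t := (k1 + _)%N in q_chain.
have q0 : q 0%N = y by rewrite ql.
have qt : q t = y by rewrite qr w23r.
have t0 : (0 < t)%N by case: q_chain => -[].
pose qz (i : int) := q (absz (i %% t)%Z).
have qzd := cycle_pseudo_orbit q_chain (etrans q0 (esym qt)).
(* A common multiple of both cycle lengths: at times 0 and [M] both cycles are at [y], so [xi] can
   switch between them. *)
pose M : nat := (l * t)%N.
pose inM (i : int) := (0 <= i) && (i < M).
pose xi i := if inM i then qz i else gz i.
have qg0 : qz 0 = gz 0 by rewrite /qz /gz !mod0z q0 g0.
have qgM : qz M = gz M.
  by rewrite /qz /gz /M PoszM modzMl mulrC modzMl q0 g0.
have xiC i : C (xi i).
  by rewrite /xi; case: ifP => _; [exact: (cycle_in q_chain)|exact: gzC].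
have xid i : mdist (f (xi i)) (xi (i + 1)) <= delta.
  have xi_q : 0 <= i + 1 <= M -> xi (i + 1) = qz (i + 1).
    rewrite /xi /inM => iM; case: ifP => // iM'.
    by have -> : i + 1 = M by move: iM iM'; lia.
  have xi_g : ~~ inM i -> xi (i + 1) = gz (i + 1).
    rewrite /xi /inM => iM; case: ifP => // iM'.
    by have -> : i + 1 = 0 by move: iM iM'; lia.
  rewrite {1}/xi; case: ifP => iM; last by rewrite xi_g ?iM //; exact: gzd.
  by rewrite xi_q; [exact: qzd|move: iM; rewrite /inM; lia].
have [x xix] := shadowing xid xiC.
have xC := shadow_near xiC xix.
exists l, p, x; split; [split=> //|exact: (pC 0)|exact: (xC 0)].
  (* At time [s] the pseudo-orbit passes through [z]. Were [x] on the orbit of [p], it would then be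
     at some [ziter f n p] with [n < l], and at time [sep n + s] too far from [ziter f (sep n) z] to
     shadow it. *)
  move=> i px; pose s : int := (k1 + N.+1)%N.
  have : ziter f s x = ziter f ((s + i) %% l)%Z p.
    by rewrite -px -ziterD (ziter_mod _ flp).
  have := @modz_ge0 (s + i) l ltac:(lia).
  have := @ltz_pmod (s + i) l ltac:(lia).
  case: (_ %% _)%Z => // n nl _ sx.
  have := sepP n; rewrite -sx -ziterD.
  have nN : (absz (sep n) <= N)%N.
    have nl' : (n < l)%N by lia.
    exact: (@leq_bigmax _ (fun n : 'I_l => absz (sep n)) (Ordinal nl')).
  have := xix (sep n + s).
  suff -> : xi (sep n + s) = ziter f (sep n) z.
    by move: eps_e; rewrite metric_sym; lra.
  pose r := absz (sep n + N.+1%:Z).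
  have rE : sep n + s = (k1 + r)%N by rewrite /r /s; lia.
  have rN : (r <= 2 * N.+1)%N by rewrite /r; lia.
  have k30 : (0 < k3)%N by case: w3_chain => -[].
  have rt : (k1 + r < t)%N by rewrite /t; lia.
  rewrite rE /xi /inM /= ifT; last by rewrite /M; nia.
  rewrite /qz modz_small /=; last by lia.
  by rewrite qr w23l // /w2 /r; congr (ziter f _ z); lia.
(* The window of radius [K] around [i] avoids the inserted stretch from 0 to [M - 1], so there [x]
   and [p] shadow the same points. *)
move=> eta /uniform_expansivity[K KP]; exists (M + K)%N => i iMK.
apply: KP; [exact: xC|exact: pC|] => j jK.
rewrite -!ziterD; apply: (shadow_close xix gp).
by rewrite /xi /inM ifF //; lia.
Qed.

End Existence.

Theorem theorem2 (R : realType) (X : metricType R)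
    (compactX : compact [set: X]) (f : homeo X) (C : set X)
    (closedC : closed C) (fC : f @` C = C)
    (infiniteC : infinite_set C)
    (chainC : chain_transitive_on f C)
    (expshC : exists2 b : R, 0 < b &
       expansive_on f (nbhd_set b C) /\ shadowing_on f (nbhd_set b C)) :
  bohr_chaotic f.
Proof.
have [b b0 [/expansive_onE[e e0 expansive] shadowing]] := expshC.
(* Half of [e] makes two shadows of one point [e]-close; half of [b] leaves room for limits. *)
pose eps := Num.min (e / 2) (b / 2).
have eps0 : 0 < eps by rewrite lt_min; lra.
have eps_b : eps < b by rewrite gt_min; lra.
have eps_e : eps + eps <= e by have : eps <= e / 2 by [rewrite ge_min lexx|]; lra.
have [delta delta0 shad] := shadowing_onE shadowing eps0.
have [|l [p [x [hom pC xC]]]] := homoclinic_exists eps_b compactX expansive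
    eps_e delta0 _ fC infiniteC chainC.
  move=> xs xsd xsC; apply: shad xsd _ => i.
  by apply: (nbhd_setI (xsC i)); rewrite mdistxx ltW.
(* The orbits of [p] and [x] need not lie in [C]: here shadowing is used on the whole
   neighbourhood. *)
exact: (homoclinic_bohr hom shadowing (near_orbit eps_b pC) (near_orbit eps_b xC)).
Qed.
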